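(* Consider the relay system described in the context under static policies with parameter $\alpha\in[0,1]$. The throughput-optimal static policy, i.e. the value $\alpha^{T}$ of $\alpha\in[0,1]$ maximizing the source throughput $\lambda_S=p^{det}_S+p^a_R\,p^{det}_R$, keeps the data buffer $Q_d$ at the boundary of stability. In addition, $$\alpha^{T}=\frac{E(\Gamma)\,p^{det}_R}{E(\Gamma)\,p^{det}_R+K(1-p^{det}_S)}.$$
   Context: Model. Parameters: $p^{det}_S,p^{det}_R\in(0,1)$; integers $b_{\max}\ge 1$, $K$, $N$ with $b_{\max}\le K$ and $N\ge 2K$; a random variable $\Gamma$ on $\{0,1,\dots,b_{\max}\}$ with $\gamma_m=\Pr\{\Gamma=m\}$, $\gamma_{b_{\max}}>0$, and mean $E(\Gamma)>0$. A relay R has an infinite data buffer $Q_d$ and an energy buffer $Q_e$ of size $N$. Time is slotted, each slot (the time unit) consisting of two equal subslots. At the beginning of a slot the state is $s=(q_d,q_e)$, with $q_d\in\{0,1,2,\dots\}$ the number of data packets in $Q_d$ and $q_e\in\{0,\dots,N\}$ the number of energy units in $Q_e$. With probability $\alpha_s$ node R chooses the data decoding (DD) mode, and otherwise the energy harvesting (EH) mode. First subslot: the source, which always has a packet, transmits, and the destination detects the packet with probability $p^{det}_S$. In DD mode, if the destination does not detect the packet (probability $1-p^{det}_S$), the packet is added to $Q_d$; $q_e$ does not change. In EH mode, $q_d$ does not change and $q_e$ becomes $\min(N,q_e+\Gamma)$; units in excess of $N$ are lost (blocked). Second subslot (using the values after the first subslot): if $Q_d$ contains at least one packet and $q_e\ge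 K$, node R is called active; it transmits the head-of-line packet (first-come first-served), $q_e$ decreases by $K$, and with probability $p^{det}_R$ the transmission succeeds and the packet leaves $Q_d$ (otherwise it stays at the head of line). If R is not active, nothing changes. All random choices (mode choices, detections, harvested amounts) are independent. A static policy has $\alpha_s=\alpha$ for all states $s$. Long-run quantities. $p^a_R$ is the long-run fraction of slots in which R is active. The source throughput is $\lambda_S=p^{det}_S+p^a_R p^{det}_R$. The data arrival rate to $Q_d$ is $\lambda_{id}=\alpha(1-p^{det}_S)$ and the data departure rate is $\lambda_{od}=p^a_R p^{det}_R$. $Q_d$ is stable if $\lambda_{id}=\lambda_{od}$ and unstable if $\lambda_{id}>\lambda_{od}$. $Q_d$ is at the boundary of stability if it is stable but becomes unstable when its arrival rate is increased by any $\epsilon>0$ (for static policies: $Q_d$ is stable at $\alpha$ and unstable at every larger $\alpha'$). *)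

(* Defs.v *)
From HB Require Import structures.
From mathcomp Require Import all_boot all_order all_algebra.
From mathcomp Require Import all_classical all_reals all_analysis.

Set Implicit Arguments.
Unset Strict Implicit.
Unset Printing Implicit Defensive.

Import Order.TTheory GRing.Theory Num.Theory.
Import numFieldNormedType.Exports.

Local Open Scope classical_set_scope.
Local Open Scope ring_scope.

(* A state (q_d, q_e): data packets and energy units at the start of a slot. *)
Definition state : Type := (nat * nat)%type.

(* State-dependent probability of choosing the data decoding mode. *)
Definition policy (R : realType) : Type := state -> R.

Definition static_policy (R : realType) (alpha : R) : policy R := fun=> alpha.

(* The outcomes of the random choices of one slot.  The relay decodes iff
   [mode_draw] is smaller than the policy's value at the current state, so that
   a uniform draw makes this happen with the prescribed probability whatever
   the policy.  [harvest] is relevant in harvesting mode only, and [detR] only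
   if the relay is active. *)
Record draws (R : realType) : Type := Draws {
  mode_draw : R;
  detS : bool;
  harvest : nat;
  detR : bool
}.

Definition first_subslot (R : realType) (N : nat) (pol : policy R)
    (x : draws R) (s : state) : state :=
  if mode_draw x < pol s then ((s.1 + ~~ detS x)%N, s.2)
  else (s.1, minn N (s.2 + harvest x)%N).

(* To be evaluated at the state reached after the first subslot. *)
Definition active (K : nat) (s : state) : bool := (0 < s.1)%N && (K <= s.2)%N.

Definition second_subslot (R : realType) (K : nat) (x : draws R)
    (s : state) : state :=
  if active K s then ((s.1 - detR x)%N, (s.2 - K)%N) else s.

Definition slot (R : realType) (K N : nat) (pol : policy R) (x : draws R)
    (s : state) : state :=
  second_subslot K x (first_subslot N pol x s).

Fixpoint state_at (R : realType) (K N : nat) (pol : policy R)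
    (x : nat -> draws R) (s0 : state) (t : nat) : state :=
  if t is t'.+1 then slot K N pol (x t') (state_at K N pol x s0 t') else s0.

Definition active_at (R : realType) (K N : nat) (pol : policy R)
    (x : nat -> draws R) (s0 : state) (t : nat) : bool :=
  active K (first_subslot N pol (x t) (state_at K N pol x s0 t)).

(* Mutual independence of a family of classes of events: the product rule for
   every finite subfamily of indices and every choice of events. *)
Definition mutually_independent (d : measure_display) (T : measurableType d)
    (R : realType) (P : probability T R) (I : eqType)
    (F : I -> set (set T)) : Prop :=
  forall (J : seq I) (E : I -> set T), uniq J ->
    (forall i, i \in J -> F i (E i)) ->
    P (\bigcap_(i in [set` J]) E i) = (\prod_(i <- J) P (E i))%E.

Record random_choices (d : measure_display) (T : measurableType d)
    (R : realType) (P : probability T R) : Type := RandomChoices {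
  rv_mode : nat -> {RV P >-> R};
  rv_detS : nat -> {RV P >-> bool};
  rv_harvest : nat -> {RV P >-> nat};
  rv_detR : nat -> {RV P >-> bool}
}.

Definition draws_of (d : measure_display) (T : measurableType d)
    (R : realType) (P : probability T R) (X : random_choices P) (w : T)
    (t : nat) : draws R :=
  Draws (rv_mode X t w) (rv_detS X t w) (rv_harvest X t w) (rv_detR X t w).

(* The sigma-algebras generated by the variables: four for each slot. *)
Definition choice_events (d : measure_display) (T : measurableType d)
    (R : realType) (P : probability T R) (X : random_choices P)
    (i : nat * 'I_4) : set (set T) :=
  tnth [tuple preimage_set_system setT (rv_mode X i.1) measurable;
              preimage_set_system setT (rv_detS X i.1) measurable;
              preimage_set_system setT (rv_harvest X i.1) measurable;
              preimage_set_system setT (rv_detR X i.1) measurable] i.2.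

Record relay_law (d : measure_display) (T : measurableType d) (R : realType)
    (P : probability T R) (pS pR : R) (gamma : nat -> R)
    (X : random_choices P) : Prop := RelayLaw {
  law_mode : forall t A, measurable A ->
    distribution P (rv_mode X t) A = uniform_prob (@ltr01 R) A;
  law_detS : forall t, P [set w | rv_detS X t w] = pS%:E;
  law_harvest : forall t m, P [set w | rv_harvest X t w = m] = (gamma m)%:E;
  law_detR : forall t, P [set w | rv_detR X t w] = pR%:E;
  law_indep : mutually_independent P (choice_events X)
}.

Definition mean_harvest (R : realType) (bmax : nat) (gamma : nat -> R) : R :=
  \sum_(m < bmax.+1) m%:R * gamma m.

(* From every initial state, the fraction of slots in which the relay is active
   converges almost surely to [p]. *)
Definition long_run_active_fraction (d : measure_display)
    (T : measurableType d) (R : realType) (P : probability T R) (K N : nat)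
    (X : random_choices P) (pol : policy R) (p : R) : Prop :=
  forall s0 : state, (s0.2 <= N)%N ->
  {ae P, forall w,
    (\sum_(0 <= t < n) (active_at K N pol (draws_of X w) s0 t)%:R) / n%:R
      @[n --> \oo] --> p}.

(* Below, [pa alpha] stands for the long-run fraction of active slots under the
   static policy with parameter [alpha]. *)

Definition source_throughput (R : realType) (pS pR : R) (pa : R -> R)
    (alpha : R) : R := pS + pa alpha * pR.

Definition arrival_rate (R : realType) (pS alpha : R) : R := alpha * (1 - pS).

Definition departure_rate (R : realType) (pR : R) (pa : R -> R)
    (alpha : R) : R := pa alpha * pR.

Definition stable (R : realType) (pS pR : R) (pa : R -> R) (alpha : R) : Prop :=
  arrival_rate pS alpha = departure_rate pR pa alpha.

Definition unstable (R : realType) (pS pR : R) (pa : R -> R)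
    (alpha : R) : Prop :=
  departure_rate pR pa alpha < arrival_rate pS alpha.

Definition boundary_of_stability (R : realType) (pS pR : R) (pa : R -> R)
    (alpha : R) : Prop :=
  stable pS pR pa alpha /\
  forall alpha', alpha < alpha' -> alpha' <= 1 -> unstable pS pR pa alpha'.

Definition throughput_optimal (R : realType) (pS pR : R) (pa : R -> R)
    (alpha : R) : Prop :=
  0 <= alpha <= 1 /\
  forall beta, 0 <= beta <= 1 ->
    source_throughput pS pR pa beta <= source_throughput pS pR pa alpha.

(* Main.v *)
Require Import Defs.
From mathcomp Require Import all_boot all_order all_algebra.
From mathcomp Require Import all_classical all_reals all_analysis.
From mathcomp Require Import measurable_realfun zify ring lra.
Import Order.TTheory GRing.Theory Num.Theory.
Import numFieldNormedType.Exports.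

Set Implicit Arguments.
Unset Strict Implicit.
Unset Printing Implicit Defensive.

Local Open Scope classical_set_scope.
Local Open Scope ring_scope.

(* Almost surely the relay is active in a fraction
   min(alpha (1 - pS) / pR, (1 - alpha) E(Gamma) / K) of the slots; the first
   term increases with alpha, the second one decreases, and they cross exactly
   at alphaT.
   The formula holds path by path, for every path obeying the law of large
   numbers.  Departures do not exceed arrivals and consumed energy does not
   exceed harvested energy: this gives the upper bound.  Except in the first
   slot, energy is lost only when the data buffer is empty: as b_max <= K and
   N >= 2 K, a nonempty buffer keeps the energy level at most N - b_max.  So
   up to the last loss everything that arrived was served, and after it all the
   harvested energy is used: this gives the lower bound.  No ergodicity of the
   buffer process is needed, and its null recurrence at alphaT is harmless.
   The law of large numbers is that of bounded martingale differences: the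
   second moment of the n-th sum is at most n, hence the averages converge
   along the squares, hence everywhere. *)

(** * Sequences of order o(n) and the fluid estimate *)

Section Sublinear.
Variable R : realType.
Implicit Types x y : nat -> R.

(** This is x n = o(n), with an additive constant in place of [eventually]. The bound then holds at
    every n, so it survives a time change k with k n <= n, even when k does not tend to infinity. *)
Definition sublinear x :=
  forall e, 0 < e -> exists M, forall n, `|x n| <= e * n%:R + M.

Lemma sublinear_cst c : sublinear (fun=> c).
Proof.
by move=> e e0; exists `|c| => n; rewrite lerDr mulr_ge0// ltW.
Qed.

Lemma sublinearD x y :
  sublinear x -> sublinear y -> sublinear (fun n => x n + y n).
Proof.
move=> hx hy e e0; have e2 : 0 < e / 2 by rewrite divr_gt0.
have [M hM] := hx _ e2; have [M' hM'] := hy _ e2.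
exists (M + M') => n; apply: le_trans (ler_normD _ _) _.
by move: (hM n) (hM' n); lra.
Qed.

Lemma sublinearZ c x : sublinear x -> sublinear (fun n => c * x n).
Proof.
move=> hx e e0; have c0 : 0 < `|c| + 1 by rewrite ltr_wpDl.
have [M hM] := hx _ (divr_gt0 e0 c0).
exists ((`|c| + 1) * M) => n; rewrite normrM.
apply: (@le_trans _ _ ((`|c| + 1) * `|x n|)).
  by rewrite ler_wpM2r// lerDl.
have -> : e * n%:R = (`|c| + 1) * (e / (`|c| + 1) * n%:R).
  by rewrite mulrA mulrCA divff ?mulr1// gt_eqF.
by rewrite -mulrDr ler_wpM2l// ltW.
Qed.

Lemma sublinearN x : sublinear x -> sublinear (fun n => - x n).
Proof. by move=> hx e /hx[M hM]; exists M => n; rewrite normrN. Qed.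

Lemma sublinear_sum (m : nat) (x : nat -> nat -> R) :
  (forall i, sublinear (x i)) ->
  sublinear (fun n => \sum_(i < m) x i n).
Proof.
move=> hx; elim: m => [|m ih].
  by under eq_fun do rewrite big_ord0; exact: sublinear_cst.
by under eq_fun do rewrite big_ord_recr; exact: sublinearD.
Qed.

Lemma sublinear_comp x (k : nat -> nat) :
  (forall n, (k n <= n)%N) -> sublinear x -> sublinear (fun n => x (k n)).
Proof.
move=> kn hx e e0; have [M hM] := hx _ e0; exists M => n.
by apply: le_trans (hM _) _; rewrite lerD2r ler_wpM2l ?ler_nat// ltW.
Qed.

Lemma sublinear_sandwich x y z :
  (forall n, y n <= x n <= z n) -> sublinear y -> sublinear z -> sublinear x.
Proof.
move=> yxz hy hz e e0; have [M hM] := hy _ e0; have [M' hM'] := hz _ e0.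
exists (`|M| + `|M'|) => n.
move: (hM n) (hM' n) (yxz n) (ler_norm M) (ler_norm M').
move: (normr_ge0 M) (normr_ge0 M').
rewrite !ler_norml.
move=> ? ? /andP[? ?] /andP[? ?] /andP[? ?] ? ?; apply/andP; split; lra.
Qed.

Lemma cvg_sublinear x p :
  sublinear (fun n => x n - p * n%:R) -> x n / n%:R @[n --> \oo] --> p.
Proof.
move=> hx; apply/cvgrPdist_le => e e0.
have [M hM] := hx _ (divr_gt0 e0 (ltr0n _ 2)).
near=> n.
have n0 : 0 < n%:R :> R by rewrite ltr0n; near: n; exists 1%N.
rewrite distrC -[p](mulfK (lt0r_neq0 n0)) -mulrBl normrM normfV.
rewrite (gtr0_norm n0) ler_pdivrMr//; apply: le_trans (hM n) _.
suff : M <= e / 2 * n%:R by lra.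
rewrite mulrC -ler_pdivrMr ?divr_gt0//; apply: ltW.
near: n; exact: nbhs_infty_gtr.
Unshelve. all: by end_near. Qed.

(* [tau n] is the last time before [n] at which energy may have been lost. *)
Lemma sublinear_fluid (SA SD SH SR : nat -> R) (tau : nat -> nat)
    (p k d h C : R) :
  0 < p -> 0 < k -> (forall n, (tau n <= n)%N) ->
  (forall n, SR n <= SD n + C) ->
  (forall n, k * SA n <= SH n + C) ->
  (forall n, SD (tau n) <= SR (tau n)) ->
  (forall n, SH n + k * SA (tau n) <= SH (tau n) + k * SA n + C) ->
  sublinear (fun n => SD n - d * n%:R) ->
  sublinear (fun n => SH n - h * n%:R) ->
  sublinear (fun n => SR n - p * SA n) ->
  sublinear (fun n => SA n - Num.min (d / p) (h / k) * n%:R).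
Proof.
move=> p0 k0 taun SRD SAH SDR SHA hD hH hR.
pose r := Num.min (d / p) (h / k).
pose eD n := SD n - d * n%:R; pose eH n := SH n - h * n%:R.
pose eR n := SR n - p * SA n.
have rn (n : nat) : 0 <= n%:R :> R by [].
apply: (@sublinear_sandwich _
  (fun n => p^-1 * (eD (tau n) + (-1) * eR (tau n))
            + k^-1 * (eH n + (-1) * eH (tau n) + (- C)))
  (fun n => if d / p <= h / k then p^-1 * (C + eD n + (-1) * eR n)
            else k^-1 * (C + eH n))).
- move=> n; apply/andP; split.
    (* Lower bound: up to [tau n] all arrivals are served, so the rate there is at least d / p. From
       [tau n] to n all harvested energy is used up to C, at rate at least h / k. Both rates are at
       least r. *)
    have rp : p * r <= d by rewrite -ler_pdivlMl// mulrC ge_min lexx.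
    have rk : k * r <= h by rewrite -ler_pdivlMl// mulrC ge_min lexx orbT.
    have tn : 0 <= n%:R - (tau n)%:R :> R by rewrite subr_ge0 ler_nat.
    have h1 : p^-1 * (eD (tau n) + (-1) * eR (tau n)) <=
        SA (tau n) - r * (tau n)%:R.
      rewrite mulrC ler_pdivrMr//; rewrite /eD /eR.
      by have := SDR n; have := ler_wpM2r (rn (tau n)) rp; lra.
    have h2 : k^-1 * (eH n + (-1) * eH (tau n) + (- C)) <=
        SA n - SA (tau n) - r * (n%:R - (tau n)%:R).
      rewrite mulrC ler_pdivrMr// /eH.
      by have := SHA n; have := ler_wpM2r tn rk; lra.
    by rewrite -/r; lra.
  (* Upper bound: the scarcer resource, data or energy, gives it. *)
  rewrite -/r; case: ifPn => [dh|]; last rewrite -ltNge => dh.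
    have -> : r = d / p by exact: min_l.
    rewrite [leRHS]mulrC ler_pdivlMr// mulrBl mulrAC divfK ?gt_eqF//.
    by rewrite /eD /eR; have := SRD n; lra.
  have -> : r = h / k by apply: min_r; exact: ltW.
  rewrite [leRHS]mulrC ler_pdivlMr// mulrBl mulrAC divfK ?gt_eqF//.
  by rewrite /eH; have := SAH n; lra.
- have cst := @sublinear_cst; have eDt := sublinear_comp taun hD.
  have eHt := sublinear_comp taun hH; have eRt := sublinear_comp taun hR.
  apply: sublinearD; apply: sublinearZ.
    by apply: sublinearD => //; exact: sublinearZ.
  by apply: sublinearD => //; apply: sublinearD => //; exact: sublinearZ.
- have cst := @sublinear_cst.
  case: (d / p <= h / k); apply: sublinearZ; last exact: sublinearD.
  by apply: sublinearD; [exact: sublinearD|exact: sublinearZ].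
Qed.

End Sublinear.

(** * Pathwise balances of data and energy *)

Section Accounting.
Variables (R : realType) (K N bmax : nat) (alpha : R).
Hypotheses (hK : (bmax <= K)%N) (hN : (2 * K <= N)%N).
Variables (x : nat -> draws R) (s0 : state).
Hypotheses (hs0 : (s0.2 <= N)%N) (hx : forall t, (harvest (x t) <= bmax)%N).

Definition decodes t := mode_draw (x t) < alpha.

Let q := state_at K N (static_policy alpha) x s0.
Let A := active_at K N (static_policy alpha) x s0.

Definition arrivals n := (\sum_(0 <= t < n) (decodes t && ~~ detS (x t)))%N.
Definition departures n := (\sum_(0 <= t < n) (A t && detR (x t)))%N.
(** Blocked units are counted too, so the energy balance is in general only an inequality. *)
Definition harvested n :=
  (\sum_(0 <= t < n) if decodes t then 0%N else harvest (x t))%N.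
Definition activity n := (\sum_(0 <= t < n) A t)%N.

Lemma data_step t :
  ((q t.+1).1 + (A t && detR (x t)) = (q t).1 + (decodes t && ~~ detS (x t)))%N.
Proof.
rewrite /q /A /active_at /= -/q /slot /second_subslot /first_subslot.
rewrite /static_policy /active -/(decodes t).
by case: (decodes t) => /=; case: ifP => //=; case: (detS (x t)) => /=;
  case: (detR (x t)) => /=; lia.
Qed.

Lemma energy_step t :
  ((q t.+1).2 + K * A t <=
   (q t).2 + if decodes t then 0 else harvest (x t))%N.
Proof.
rewrite /q /A /active_at /= -/q /slot /second_subslot /first_subslot.
rewrite /static_policy /active -/(decodes t).
case: (decodes t) => /=; case: ifP => //= h; lia.
Qed.

Lemma energy_le t : ((q t).2 <= N)%N.
Proof.
elim: t => [|t ih]; first exact: hs0.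
rewrite /q /= -/q /slot /second_subslot /first_subslot.
rewrite /static_policy /active -/(decodes t).
case: (decodes t) => /=; case: ifP => //= h; lia.
Qed.

(** If the relay was active in slot t, the level is at most N - K, and bmax <= K. If it was inactive
    with data left, the level is below K, and K + bmax <= 2 K <= N. The initial state is arbitrary,
    hence the index [t.+1]. *)
Lemma energy_low t : (0 < (q t.+1).1)%N -> ((q t.+1).2 + bmax <= N)%N.
Proof.
have := energy_le t.
rewrite /q /= -/q /slot /second_subslot /first_subslot.
rewrite /static_policy /active -/(decodes t).
case: (decodes t) => /=; case: ifP => //= h; lia.
Qed.

Lemma energy_step_eq t : ((q t).2 + bmax <= N)%N ->
  ((q t.+1).2 + K * A t =
   (q t).2 + if decodes t then 0 else harvest (x t))%N.
Proof.
move: (hx t).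
rewrite /q /A /active_at /= -/q /slot /second_subslot /first_subslot.
rewrite /static_policy /active -/(decodes t).
case: (decodes t) => /=; case: ifP => //= h; lia.
Qed.

Lemma data_balance n : ((q n).1 + departures n = s0.1 + arrivals n)%N.
Proof.
rewrite /departures /arrivals; elim: n => [|n ih]; first by rewrite !big_nil.
by rewrite !big_nat_recr//=; have := data_step n; lia.
Qed.

Lemma harvestedS n : harvested n.+1 =
  (harvested n + if decodes n then 0%N else harvest (x n))%N.
Proof. by rewrite /harvested big_nat_recr. Qed.

Lemma activityS n : activity n.+1 = (activity n + A n)%N.
Proof. by rewrite /activity big_nat_recr. Qed.

Lemma energy_balance n : ((q n).2 + K * activity n <= s0.2 + harvested n)%N.
Proof.
elim: n => [|n ih].
  by rewrite /activity /harvested !big_nil muln0.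
by rewrite harvestedS activityS mulnDr; have := energy_step n; lia.
Qed.

(** By induction on n: [tau] is kept while the buffer has room for a full harvest, and reset to n
    otherwise. The third bound says that after [tau] unspent energy is merely stored, up to one
    harvest. *)
Lemma last_loss n : exists tau,
  [/\ (tau <= n)%N, (arrivals tau <= departures tau)%N
    & (harvested n + K * activity tau <=
       harvested tau + K * activity n + (q n).2 + bmax)%N].
Proof.
elim: n => [|n [tau [taun hD hH]]].
  by exists 0%N; split => //; rewrite /arrivals /departures ?big_nil//; lia.
have [low|high] := leqP ((q n).2 + bmax) N.
  exists tau; split => //; first lia.
  rewrite harvestedS activityS mulnDr.
  by have := energy_step_eq low; lia.
exists n; split => //.
  (* There is no room for a full harvest: either nothing has arrived yet (n = 0), or the
     contrapositive of [energy_low] empties the data buffer. *)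
  case: n high {hH taun} => [|n] high; first by rewrite /arrivals big_nil.
  have q0 : (q n.+1).1 = 0%N.
    by apply/eqP; rewrite -leqn0 leqNgt; apply/negP => /energy_low; lia.
  by have := data_balance n.+1; rewrite q0; lia.
rewrite harvestedS activityS mulnDr.
by have := hx n; case: ifP => _; lia.
Qed.

Lemma activity_rate (p d h : R) : 0 < p -> (0 < K)%N ->
  sublinear (fun n => (arrivals n)%:R - d * n%:R) ->
  sublinear (fun n => (harvested n)%:R - h * n%:R) ->
  sublinear (fun n => (departures n)%:R - p * (activity n)%:R) ->
  sublinear (fun n => (activity n)%:R - Num.min (d / p) (h / K%:R) * n%:R).
Proof.
move=> p0 K0 hD hH hR.
have [tau htau] := choice last_loss.
(* The constant covers the initial packets, the stored energy (at most N) and one harvest. *)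
apply: (@sublinear_fluid _ (fun n => (activity n)%:R)
  (fun n => (arrivals n)%:R) (fun n => (harvested n)%:R)
  (fun n => (departures n)%:R) tau p K%:R d h (s0.1 + N + bmax)%N%:R);
  rewrite ?ltr0n//.
- by move=> n; have [] := htau n.
- move=> n; rewrite -natrD ler_nat; have := data_balance n; lia.
- move=> n; rewrite -natrD -natrM ler_nat; have := energy_balance n.
  by move: hs0; lia.
- by move=> n; rewrite ler_nat; have [] := htau n.
- move=> n; have [_ _] := htau n; rewrite -!natrM -!natrD ler_nat.
  by have := energy_le n; lia.
Qed.

End Accounting.

(** * Law of large numbers for bounded orthogonal terms *)

(** Any n lies within 2 k of some square k ^ 2 <= n, and x moves by at most 1 per step, so the
    change since that square is o(n). *)
Lemma sublinear_squares (R : realType) (x : nat -> R) :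
  x 0%N = 0 -> (forall n, `|x n.+1 - x n| <= 1) ->
  x (n.+1 ^ 2)%N / (n.+1 ^ 2)%:R @[n --> \oo] --> 0 -> sublinear x.
Proof.
move=> x0 dx /cvgrPdist_le hx e e0.
have xD n m : `|x (n + m)%N - x n| <= m%:R.
  elim: m => [|m ih]; first by rewrite addn0 subrr normr0.
  rewrite addnS -[m.+1]addn1 natrD.
  have -> : x (n + m).+1 - x n =
      (x (n + m)%N - x n) + (x (n + m).+1 - x (n + m)%N).
    by ring.
  by apply: le_trans (ler_normD _ _) _; rewrite lerD.
have e2 : 0 < e / 2 by rewrite divr_gt0.
have [k0 _ hk0] := hx _ e2.
(* The first term settles n below the square of [k0.+1], where |x n| <= n. The term 2 / e is what
   the gap between squares leaves over. *)
exists ((k0.+1 ^ 2)%:R + 2 / e + 1) => n.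
have ie : 0 < 2 / e by rewrite divr_gt0.
have [nk|kn] := ltnP n (k0.+1 ^ 2).
  have := xD 0%N n; rewrite x0 subr0 add0n => /le_trans; apply.
  have : n%:R <= (k0.+1 ^ 2)%:R :> R by rewrite ler_nat ltnW.
  have : 0 <= e * n%:R by rewrite mulr_ge0// ltW.
  by move: ie; lra.
have [k [k0k kn1 kn2]] : exists k, [/\ (k0 <= k)%N, (k.+1 ^ 2 <= n)%N
    & (n <= k.+1 ^ 2 + 2 * k.+1)%N].
  elim: n kn => [|n ih]; first by move=> ?; lia.
  rewrite leq_eqVlt => /predU1P[<-|/ih[k [h1 h2 h3]]].
    by exists k0; split => //; lia.
  have [l|l] := leqP n.+1 (k.+1 ^ 2 + 2 * k.+1).
    by exists k; split => //; lia.
  by exists k.+1; split; lia.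
have := hk0 k k0k; rewrite /= sub0r normrN normrM normfV.
have s0 : 0 < (k.+1 ^ 2)%:R :> R by rewrite ltr0n expn_gt0.
rewrite (gtr0_norm s0) ler_pdivrMr// => hxk.
have := xD (k.+1 ^ 2)%N (n - k.+1 ^ 2)%N; rewrite subnKC// => hd.
have : (n - k.+1 ^ 2)%:R <= 2 * k.+1%:R :> R.
  by rewrite -natrM ler_nat; lia.
have : (k.+1 ^ 2)%:R <= n%:R :> R by rewrite ler_nat.
have -> : x n = x (k.+1 ^ 2)%N + (x n - x (k.+1 ^ 2)%N) by ring.
move=> h1 h2; apply: le_trans (ler_normD _ _) _.
(* AM-GM *)
have : 2 * k.+1%:R <= e / 2 * (k.+1 ^ 2)%:R + 2 / e.
  rewrite natrX -subr_ge0.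
  have -> : e / 2 * k.+1%:R ^+ 2 + 2 / e - 2 * k.+1%:R =
      e / 2 * (k.+1%:R - 2 / e) ^+ 2.
    by field; rewrite gt_eqF.
  by rewrite mulr_ge0 ?sqr_ge0// ltW.
have : e * (k.+1 ^ 2)%:R <= e * n%:R by rewrite ler_wpM2l// ltW.
by have := ler0n R (k0.+1 ^ 2); lra.
Qed.

Lemma sum_inv_squares_le (R : realType) n :
  \sum_(0 <= k < n) ((k.+1%:R : R) ^+ 2)^-1 <= 2.
Proof.
(* The remainder 1 / (m + 1) makes the induction go through, since 1 / (m + 2) ^ 2 <= 1 / (m + 1) -
   1 / (m + 2). *)
suff H m : \sum_(0 <= k < m.+1) ((k.+1%:R : R) ^+ 2)^-1 <= 2 - m.+1%:R^-1.
  case: n => [|n]; first by rewrite big_nil.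
  by apply: le_trans (H n) _; rewrite gerBl invr_ge0.
elim: m => [|m ih]; first by rewrite big_nat1 expr1n invr1; lra.
rewrite big_nat_recr//=; apply: le_trans (lerD ih (lexx _)) _.
have m1 : 0 < m.+1%:R :> R by [].
rewrite -[m.+2%:R]natr1; set a : R := m.+1%:R in m1 *.
rewrite -subr_ge0.
have -> : 2 - (a + 1)^-1 - (2 - a^-1 + ((a + 1) ^+ 2)^-1) =
    (a * (a + 1) ^+ 2)^-1.
  by field; rewrite !gt_eqF// addr_gt0.
by rewrite invr_ge0 mulr_ge0 ?sqr_ge0// ltW.
Qed.

Section BoundedMeasurable.
Context d (T : measurableType d) (R : realType) (P : probability T R).
Implicit Types f g : T -> R.

(** A class closed under sums and products, whose members are all integrable for a probability; it
    discharges every integrability condition below. *)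
Definition bounded_measurable f :=
  measurable_fun setT f /\ exists M, forall w, `|f w| <= M.

Lemma bounded_measurable_cst c : bounded_measurable (fun=> c).
Proof. by split; [exact: measurable_cst|exists `|c|]. Qed.

Lemma bounded_measurableD f g : bounded_measurable f -> bounded_measurable g ->
  bounded_measurable (fun w => f w + g w).
Proof.
move=> [mf [M hM]] [mg [M' hM']]; split; first exact: measurable_funD.
by exists (M + M') => w; apply: le_trans (ler_normD _ _) _; rewrite lerD.
Qed.

Lemma bounded_measurableM f g : bounded_measurable f -> bounded_measurable g ->
  bounded_measurable (fun w => f w * g w).
Proof.
move=> [mf [M hM]] [mg [M' hM']]; split; first exact: measurable_funM.
by exists (M * M') => w; rewrite normrM ler_pM.
Qed.

Lemma bounded_measurable_sum (I : Type) (r : seq I) (F : I -> T -> R) :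
  (forall i, bounded_measurable (F i)) ->
  bounded_measurable (fun w => \sum_(i <- r) F i w).
Proof.
move=> hF; elim: r => [|i r ih].
  by under eq_fun do rewrite big_nil; exact: bounded_measurable_cst.
by under eq_fun do rewrite big_cons; exact: bounded_measurableD.
Qed.

Lemma bounded_measurable_indic A : measurable A -> bounded_measurable (\1_A).
Proof.
move=> mA; split; first exact: measurable_indic.
by exists 1 => w; rewrite indicE; case: (_ \in _); rewrite ?normr0 ?normr1.
Qed.

Lemma bounded_measurable_integrable f :
  bounded_measurable f -> P.-integrable setT (EFin \o f).
Proof.
move=> [mf [M hM]]; apply: measurable_bounded_integrable => //.
  by rewrite (le_lt_trans (probability_le1 P measurableT))// ltry.
exists M; split; first exact: num_real.
by move=> y My w _; apply: le_trans (hM w) (ltW My).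
Qed.

Lemma Rintegral_prob_cst c : \int[P]_w c = c.
Proof.
rewrite Rintegral_cst// -[RHS]mulr1; congr (_ * _).
exact: (congr1 fine (probability_setT P)).
Qed.

Variable Y : nat -> T -> R.
Hypothesis mY : forall n, measurable_fun setT (Y n).
Hypothesis Y1 : forall n w, `|Y n w| <= 1.
Let S n w := \sum_(0 <= t < n) Y t w.
(** The martingale property enters only through this orthogonality of each term to the sum of the
    earlier ones. *)
Hypothesis SY : forall n, \int[P]_w (S n w * Y n w) = 0.

Let bmY n : bounded_measurable (Y n). Proof. by split => //; exists 1. Qed.
Let bmS n : bounded_measurable (S n).
Proof. exact: bounded_measurable_sum. Qed.

(** In the expanded square of S n + Y n the cross term integrates to 0, and the square of Y n adds
    at most 1. *)
Lemma second_moment_le n : \int[P]_w (S n w ^+ 2) <= n%:R.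
Proof.
elim: n => [|n ih].
  under eq_Rintegral do rewrite /S big_nil expr0n.
  by rewrite Rintegral_prob_cst.
have -> : \int[P]_w (S n.+1 w ^+ 2) =
   \int[P]_w (S n w * S n w + (2 * (S n w * Y n w) + Y n w * Y n w)).
  by apply: eq_Rintegral => w _; rewrite /S big_nat_recr//=; ring.
have bi := bounded_measurable_integrable.
have bM := bounded_measurableM; have bD := bounded_measurableD.
have iSS : bounded_measurable (fun w => S n w * S n w) by exact: bM.
have iYY : bounded_measurable (fun w => Y n w * Y n w) by exact: bM.
have iSY : bounded_measurable (fun w => S n w * Y n w) by exact: bM.
have i2SY : bounded_measurable (fun w => 2 * (S n w * Y n w)).
  by apply: bM => //; exact: bounded_measurable_cst.
rewrite RintegralD//; [|exact: bi|by apply: bi; exact: bD].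
rewrite RintegralD//; [|exact: bi|exact: bi].
rewrite RintegralZl//; last exact: bi.
rewrite SY mulr0 add0r -natr1 lerD//.
rewrite -[leRHS](Rintegral_prob_cst 1); apply: le_Rintegral => //.
- exact: bi.
- by apply: bi; exact: bounded_measurable_cst.
- move=> w _; rewrite -expr2 -real_normK ?num_real// expr_le1//.
Qed.

(** The squared averages [u k] at the times (k + 1) ^ 2 have integrals at most 1 / (k + 1) ^ 2.
    Their sum is thus integrable, hence almost everywhere finite, so [u k] tends to 0;
    [sublinear_squares] fills the gaps. *)
Lemma ae_sublinear_sum : {ae P, forall w, sublinear (S ^~ w)}.
Proof.
pose u k w := (S (k.+1 ^ 2)%N w / (k.+1 ^ 2)%:R) ^+ 2.
have u0 k w : 0 <= u k w by exact: sqr_ge0.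
have bmu k : bounded_measurable (u k).
  rewrite /u; under eq_fun do rewrite expr2.
  have b : bounded_measurable (fun w => S (k.+1 ^ 2)%N w / (k.+1 ^ 2)%:R).
    by apply: bounded_measurableM => //; exact: bounded_measurable_cst.
  exact: bounded_measurableM.
have mu k : measurable_fun setT (EFin \o u k).
  by apply/measurable_EFinP; case: (bmu k).
have Iu k : (\int[P]_w (u k w)%:E <= ((k.+1%:R ^+ 2)^-1)%:E)%E.
  have -> : (\int[P]_w (u k w)%:E = (\int[P]_w u k w)%:E)%E.
    rewrite /Rintegral fineK//.
    exact/integrable_fin_num/bounded_measurable_integrable.
  rewrite lee_fin.
  have -> : \int[P]_w u k w =
      \int[P]_w ((((k.+1 ^ 2)%:R ^+ 2)^-1) * (S (k.+1 ^ 2)%N w ^+ 2)).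
    by apply: eq_Rintegral => w _; rewrite /u exprMn exprVn mulrC.
  rewrite RintegralZl//; last first.
    apply: bounded_measurable_integrable.
    by under eq_fun do rewrite expr2; exact: bounded_measurableM.
  apply: le_trans (ler_wpM2l _ (second_moment_le _)) _.
    by rewrite invr_ge0 sqr_ge0.
  have a0 : k.+1%:R != 0 :> R by rewrite pnatr_eq0.
  rewrite natrX; set a : R := k.+1%:R in a0 *.
  by rewrite le_eqVlt; apply/orP; left; apply/eqP; field.
have IZ : (\int[P]_w (\sum_(k <oo) (u k w)%:E) <= 2%:E)%E.
  rewrite integral_nneseries//; last by move=> k w _; rewrite lee_fin.
  apply: lime_le.
    apply: is_cvg_nneseries => k _ _; apply: integral_ge0 => w _.
    by rewrite lee_fin.
  apply: nearW => n.
  apply: (@le_trans _ _ (\sum_(0 <= k < n) ((k.+1%:R ^+ 2)^-1)%:E)%E).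
    by apply: lee_sum => k _; exact: Iu.
  by rewrite sumEFin lee_fin sum_inv_squares_le.
have Z0 w : (0 <= \sum_(k <oo) (u k w)%:E)%E.
  by apply: nneseries_ge0 => k _ _; rewrite lee_fin.
have iZ : P.-integrable setT (fun w => \sum_(k <oo) (u k w)%:E)%E.
  apply/integrableP; split.
    apply: ge0_emeasurable_sum => [k w _ _|k _]; first by rewrite lee_fin.
  exact: mu.
  under eq_integral do rewrite gee0_abs//.
  by apply: le_lt_trans IZ _; rewrite ltry.
have := integrable_ae measurableT iZ; apply: filterS => w /(_ I) Zw.
apply: sublinear_squares.
- by rewrite /S big_nil.
- by move=> n; rewrite /S big_nat_recr//= addrAC subrr add0r.
have := nnseries_is_cvg (u0^~ w).
rewrite -ge0_fin_numE// => /(_ Zw) /cvg_series_cvg_0 cu.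
apply/cvgrPdist_le => e e0; move/cvgrPdist_le: cu => /(_ _ (exprn_gt0 2 e0)).
apply: filterS => n; rewrite !sub0r !normrN normrX ler_sqr// nnegrE.
exact: ltW.
Qed.

End BoundedMeasurable.

(** * Independence of each outcome from its past *)

Section Outcomes.
Context d (T : measurableType d) (R : realType) (P : probability T R).
Variables (X : random_choices P) (alpha : R) (N : nat).

(* The random choices in chronological order, four per slot, reduced to what
   the buffers depend on: finitely many values. *)
Definition outcome (j : nat) (w : T) : nat :=
  let x := draws_of X w (j %/ 4) in
  nth 0%N [:: nat_of_bool (mode_draw x < alpha); nat_of_bool (detS x);
              minn N (harvest x); nat_of_bool (detR x)] (j %% 4).

(** Stands for measurability with respect to the first j outcomes; as these take finitely many
    values, no generated sigma-algebra is involved. *)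
Definition determined (U : Type) (j : nat) (f : T -> U) :=
  forall w w', (forall i, (i < j)%N -> outcome i w = outcome i w') ->
    f w = f w'.

(** The bound [N.+2] leaves room for truncated harvests up to N and for the value 1 of a boolean,
    whatever N. *)
Lemma outcome_lt j w : (outcome j w < N.+2)%N.
Proof.
rewrite /outcome; have := ltn_pmod j (isT : 0 < 4)%N.
case: (j %% 4)%N => [|[|[|[|//]]]] _ /=.
- by case: (_ < _).
- by case: (rv_detS _ _ _).
- by rewrite ltnS (leq_trans (geq_minl _ _)).
- by case: (rv_detR _ _ _).
Qed.

Definition choice_index (j : nat) : nat * 'I_4 := (j %/ 4, inord (j %% 4))%N.

Lemma choice_index_inj : injective choice_index.
Proof.
move=> i j [ij] /(congr1 val); rewrite /= !inordK ?ltn_pmod// => ij4.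
by rewrite (divn_eq i 4) (divn_eq j 4) ij ij4.
Qed.

Lemma outcome_event j (B : set nat) :
  choice_events X (choice_index j) (outcome j @^-1` B).
Proof.
have mb (D : set bool) : measurable D by [].
rewrite /choice_events /choice_index /outcome (tnth_nth set0) /=.
rewrite inordK ?ltn_pmod//.
have := ltn_pmod j (isT : 0 < 4)%N; move: (j %/ 4)%N => t.
case: (j %% 4)%N => [|[|[|[|//]]]] _ /=.
- exists [set x | B (nat_of_bool (x < alpha))]; last by rewrite setTI.
  rewrite -[X in measurable X]setTI.
  have -> : [set x : R | B (x < alpha)] =
      (fun x => x < alpha) @^-1` [set b : bool | B b].
    by [].
  apply: measurable_fun_ltr => //.
- by exists [set b : bool | B b] => //; rewrite setTI.
- by exists [set h : nat | B (minn N h)] => //; rewrite setTI.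
- by exists [set b : bool | B b] => //; rewrite setTI.
Qed.

Lemma measurable_outcome j (B : set nat) : measurable (outcome j @^-1` B).
Proof.
have := outcome_event j B; move: (outcome j @^-1` B) => A.
rewrite /choice_events; move: (choice_index j) => [t [k hk]] /=.
case: k hk => [|[|[|[|//]]]] hk; rewrite (tnth_nth set0) /=;
  by case=> D mD <-; exact: measurable_funPT.
Qed.

Hypothesis indep : mutually_independent P (choice_events X).

Lemma indep_outcomes j (B : nat -> set nat) :
  P (\bigcap_(i < j) (outcome i @^-1` B i)) =
  (\prod_(0 <= i < j) P (outcome i @^-1` B i))%E.
Proof.
(* A left inverse of [choice_index], which lets the events be indexed by pairs as in
   [mutually_independent]. *)
pose rank (i : nat * 'I_4) := (4 * i.1 + i.2)%N.
have rankK i : rank (choice_index i) = i.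
  by rewrite /rank /= inordK ?ltn_pmod// mulnC -divn_eq.
have uJ : uniq (map choice_index (index_iota 0 j)).
  by rewrite map_inj_uniq ?iota_uniq//; exact: choice_index_inj.
have eJ i : i \in map choice_index (index_iota 0 j) ->
    choice_events X i (outcome (rank i) @^-1` B (rank i)).
  by move=> /mapP[k _ ->]; rewrite rankK; exact: outcome_event.
transitivity (\prod_(i <- map choice_index (index_iota 0 j))
    P (outcome (rank i) @^-1` B (rank i)))%E; last first.
  by rewrite big_map; apply: eq_bigr => i _; rewrite rankK.
rewrite -(indep uJ eJ).
congr (P _); apply/seteqP; split => w /= hw.
  move=> i /= /mapP[k]; rewrite mem_index_iota => /= kj e.
  by rewrite e rankK; exact: hw.
move=> k /= kj; have := hw (choice_index k); rewrite /= rankK; apply.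
by rewrite map_f// mem_index_iota.
Qed.

(** The fibres of this map are the finitely many atoms generated by the first j outcomes. *)
Definition past (j : nat) (w : T) : {ffun 'I_j -> 'I_N.+2} :=
  [ffun i : 'I_j => inord (outcome i w)].

Lemma pastE j h :
  past j @^-1` [set h] = \bigcap_(i < j)
    (outcome i @^-1` [set v : nat | forall ij : (i < j)%N, v = h (Ordinal ij)]).
Proof.
apply/seteqP; split => w /=.
  by move=> <- i /= ij ij'; rewrite ffunE inordK// outcome_lt.
move=> hw; apply/ffunP => -[i ij]; apply: val_inj.
by rewrite ffunE /= inordK ?outcome_lt//; exact: hw.
Qed.

Lemma measurable_past j h : measurable (past j @^-1` [set h]).
Proof.
rewrite pastE; apply: bigcap_measurableType => i _.
exact: measurable_outcome.
Qed.

(** An atom of the past is a rectangle by [pastE]; the product rule for j + 1 outcomes is compared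
    with the one for j. *)
Lemma indep_past j h (C : set nat) :
  P (past j @^-1` [set h] `&` outcome j @^-1` C) =
  (P (past j @^-1` [set h]) * P (outcome j @^-1` C))%E.
Proof.
rewrite pastE.
set B := fun i =>
  [set v : nat | forall ij : (i < j)%N, v = h (Ordinal ij)] : set nat.
pose B' i := if (i < j)%N then B i else C.
have B'B i : (i < j)%N -> B' i = B i by rewrite /B' => ->.
have B'C : B' j = C by rewrite /B' ltnn.
have := indep_outcomes j.+1 B'; rewrite big_nat_recr//= B'C.
under eq_big_nat => i /andP[_ ij] do rewrite B'B//.
rewrite -indep_outcomes => <-; congr (P _); apply/seteqP; split => w /=.
  move=> [h1 h2] i /=; rewrite ltnS leq_eqVlt => /predU1P[->|ij].
    by rewrite B'C.
  by rewrite B'B//; exact: h1.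
move=> hw; split; last by have := hw j (ltnSn j); rewrite /= B'C.
by move=> i /= ij; have := hw i (leqW ij); rewrite /= B'B.
Qed.

Lemma determined_past (U : pointedType) j (g : T -> U) : determined j g ->
  exists G : {ffun 'I_j -> 'I_N.+2} -> U, forall w, g w = G (past j w).
Proof.
move=> dg.
suff /choice[G hG] : forall h, exists r, forall w, past j w = h -> g w = r.
  by exists G => w; exact: hG.
move=> h; have [[w0 h0]|no] := pselect (exists w, past j w = h); last first.
  (* A history that never occurs gets an arbitrary value. *)
  by exists point => w wh; exfalso; apply: no; exists w.
exists (g w0) => w wh; apply: dg => i ij.
have /ffunP/(_ (Ordinal ij))/(congr1 val) := etrans wh (esym h0).
by rewrite !ffunE /= !inordK ?outcome_lt.
Qed.

Lemma sum_past j (G : {ffun 'I_j -> 'I_N.+2} -> R) w :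
  G (past j w) = \sum_(h <- enum {ffun 'I_j -> 'I_N.+2})
    G h * \1_(past j @^-1` [set h]) w.
Proof.
rewrite big_enum /= (bigD1 (past j w))//= big1 ?addr0.
  by rewrite indicE mem_set// mulr1.
by move=> h hp; rewrite indicE memNset ?mulr0//= => /esym/eqP; apply/negP.
Qed.

Lemma determined_bounded_measurable j (g : T -> R) :
  determined j g -> bounded_measurable g.
Proof.
move=> /determined_past[G gG].
have -> : g = fun w => \sum_(h <- enum {ffun 'I_j -> 'I_N.+2})
    G h * \1_(past j @^-1` [set h]) w.
  by apply/funext => w; rewrite gG sum_past.
apply: bounded_measurable_sum => h; apply: bounded_measurableM.
  exact: bounded_measurable_cst.
by apply: bounded_measurable_indic; exact: measurable_past.
Qed.

Lemma Rintegral_sum (I : Type) (r : seq I) (F : I -> T -> R) :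
  (forall i, bounded_measurable (F i)) ->
  \int[P]_w (\sum_(i <- r) F i w) = \sum_(i <- r) \int[P]_w F i w.
Proof.
move=> hF; elim: r => [|i r ih].
  rewrite big_nil; under eq_Rintegral do rewrite big_nil.
  exact: Rintegral_prob_cst.
rewrite big_cons -ih; under eq_Rintegral do rewrite big_cons.
rewrite RintegralD//; apply: bounded_measurable_integrable => //.
exact: bounded_measurable_sum.
Qed.

Lemma Rintegral_indic (A : set T) : measurable A ->
  \int[P]_w (\1_A w : R) = fine (P A).
Proof. by move=> mA; rewrite /Rintegral integral_indic// setIT. Qed.

(** On each atom of the past g is constant, and the event that outcome j equals v is independent of
    the atom with probability p, so every atom contributes 0. *)
Lemma orthogonal_past j (g : T -> R) (v : nat) (p : R) : determined j g ->
  P (outcome j @^-1` [set v]) = p%:E ->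
  \int[P]_w (g w * ((outcome j w == v)%:R - p)) = 0.
Proof.
move=> dg Pv; have [G gG] := determined_past dg.
set V := outcome j @^-1` [set v] in Pv.
have mV : measurable V by exact: measurable_outcome.
have mp := @measurable_past j.
have -> : \int[P]_w (g w * ((outcome j w == v)%:R - p)) =
    \int[P]_w (\sum_(h <- enum {ffun 'I_j -> 'I_N.+2})
      (G h * \1_(past j @^-1` [set h] `&` V) w +
      (- (G h * p)) * \1_(past j @^-1` [set h]) w)).
  apply: eq_Rintegral => w _; rewrite gG sum_past big_distrl /=.
  apply: eq_bigr => h _; rewrite indicI /=.
  have -> : \1_V w = (outcome j w == v)%:R :> R.
    rewrite indicE; suff -> : (w \in V) = (outcome j w == v) by [].
    by apply/idP/eqP; rewrite inE.
  by ring.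
have b c A : measurable A -> bounded_measurable (fun w => c * \1_A w : R).
  move=> mA; apply: bounded_measurableM; first exact: bounded_measurable_cst.
  exact: bounded_measurable_indic.
rewrite Rintegral_sum; last first.
  by move=> h; apply: bounded_measurableD; apply: b => //; exact: measurableI.
apply: big1 => h _; have mI : measurable (past j @^-1` [set h] `&` V).
  exact: measurableI.
rewrite RintegralD//; [|exact/bounded_measurable_integrable/b..].
rewrite !RintegralZl//;
  [|exact/bounded_measurable_integrable/bounded_measurable_indic..].
rewrite !Rintegral_indic// indep_past Pv fineM ?fin_num_measure//=.
by ring.
Qed.

(** A martingale transform: the centred indicator of draw k in slot t is weighted by a factor known
    before that draw. *)
Lemma sublinear_martingale k (g : nat -> T -> R) (v : nat) (p : R) :
  (forall t, determined (4 * t + k) (g t)) -> (forall t w, `|g t w| <= 1) ->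
  (forall t, P (outcome (4 * t + k) @^-1` [set v]) = p%:E) ->
  {ae P, forall w, sublinear (fun n =>
    \sum_(0 <= t < n) g t w * ((outcome (4 * t + k) w == v)%:R - p))}.
Proof.
move=> dg g1 Pv.
have p01 : 0 <= p <= 1.
  rewrite -!lee_fin -(Pv 0%N) measure_ge0/= probability_le1//.
  exact: measurable_outcome.
pose Y t w := g t w * ((outcome (4 * t + k) w == v)%:R - p).
have dY t : determined (4 * t + k).+1 (Y t).
  move=> w w' ww'; rewrite /Y ww'// (dg t w w')// => i ij.
  by apply: ww'; exact: leqW.
apply: (@ae_sublinear_sum _ _ _ P Y).
- by move=> t; have [] := determined_bounded_measurable (dY t).
- move=> t w; rewrite /Y normrM mulr_ile1// ler_norml.
  by case: eqP => _ /=; apply/andP; split; lra.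
(* For t < n, [Y t] depends on outcomes of index at most 4 t + k < 4 n + k, so the partial sum
   belongs to the past of draw k in slot n. *)
- move=> n; rewrite /Y; under eq_Rintegral do rewrite mulrA.
  apply: orthogonal_past => // w w' ww'.
  rewrite (dg n w w')//; congr (_ * _).
  rewrite big_nat_cond [RHS]big_nat_cond; apply: eq_bigr => t.
  rewrite andbT => /andP[_ tn]; apply: dY => i it; apply: ww'; lia.
Qed.

End Outcomes.

(** * Long-run activity of the relay *)

Lemma uniform_prob_lt (R : realType) (a : R) : 0 <= a <= 1 ->
  uniform_prob (@ltr01 R) [set x | x < a] = a%:E.
Proof.
move=> /andP[a0 a1].
rewrite /uniform_prob integral_uniform_pdf.
have -> : [set x | x < a] `&` `[0, 1]%classic = `[0, a[%classic :> set R.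
  apply/seteqP; split => x /=; rewrite !in_itv /=.
    by move=> [-> /andP[-> _]].
  by move=> /andP[x0 xa]; split => //; rewrite x0 (le_trans (ltW xa)).
rewrite (eq_integral (cst 1%E)) => [|x].
  by rewrite integral_cst//= mul1e lebesgue_measure_itv /= lte_fin;
    case: ltP => [_|a0']; [rewrite oppr0 addr0|
      congr EFin; apply/eqP; rewrite eq_le a0 a0'].
rewrite inE /= in_itv /= => /andP[x0 xa].
by rewrite /uniform_pdf x0 (le_trans (ltW xa) a1) /= subr0 invr1.
Qed.

Section Relay.
Context d (T : measurableType d) (R : realType) (P : probability T R).
Variables (pS pR : R) (bmax K N : nat) (gamma : nat -> R).
Hypotheses (hbmax : (1 <= bmax)%N) (hK : (bmax <= K)%N) (hN : (2 * K <= N)%N).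
Hypothesis hgamma_supp : forall m, (bmax < m)%N -> gamma m = 0.
Hypothesis hpR : 0 < pR.
Variables (X : random_choices P) (hX : relay_law pS pR gamma X).
Variables (alpha : R) (halpha : 0 <= alpha <= 1) (s0 : state).
Hypothesis hs0 : (s0.2 <= N)%N.

Let o := outcome X alpha N.
Let x (w : T) (t : nat) := draws_of X w t.
Let c w t := decodes alpha (x w) t.
Let q w t := state_at K N (static_policy alpha) (x w) s0 t.
Let A w t := active_at K N (static_policy alpha) (x w) s0 t.

Lemma outcomeE t k w : (k < 4)%N -> o (4 * t + k) w =
  nth 0%N [:: nat_of_bool (c w t); nat_of_bool (detS (x w t));
              minn N (harvest (x w t)); nat_of_bool (detR (x w t))] k.
Proof.
move=> k4; rewrite /o /outcome mulnC divnMDl// divn_small// addn0.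
by rewrite modnMDl modn_small.
Qed.

Lemma outcome_decodes t w : (o (4 * t + 0) w == 1%N) = c w t.
Proof. by rewrite outcomeE//=; case: c. Qed.

Lemma outcome_detS t w : (o (4 * t + 1) w == 0%N) = ~~ detS (x w t).
Proof. by rewrite outcomeE//=; case: (rv_detS X t w). Qed.

Lemma outcome_harvest t w m : (m < N)%N ->
  (o (4 * t + 2) w == m) = (harvest (x w t) == m).
Proof. by move=> mN; rewrite outcomeE//=; lia. Qed.

Lemma outcome_detR t w : (o (4 * t + 3) w == 1%N) = detR (x w t).
Proof. by rewrite outcomeE//=; case: (rv_detR X t w). Qed.

Lemma prob_decodes t : P (o (4 * t + 0) @^-1` [set 1%N]) = alpha%:E.
Proof.
rewrite -(uniform_prob_lt halpha) -(law_mode hX t).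
  congr (P _); apply/seteqP; split => w /=.
    by move=> /eqP; rewrite outcome_decodes.
  by move=> h; apply/eqP; rewrite outcome_decodes.
exact: measurable_itv `]-oo, alpha[.
Qed.

Lemma prob_not_detS t : P (o (4 * t + 1) @^-1` [set 0%N]) = (1 - pS)%:E.
Proof.
rewrite EFinB -(law_detS hX t) -probability_setC.
  congr (P _); apply/seteqP; split => w /=.
    by move=> /eqP; rewrite outcome_detS => /negP.
  by move=> /negP h; apply/eqP; rewrite outcome_detS.
exact: (measurable_funPTI (rv_detS X t) (Y := [set b : bool | b])).

Qed.

Lemma prob_harvest t m : (m <= bmax)%N ->
  P (o (4 * t + 2) @^-1` [set m]) = (gamma m)%:E.
Proof.
(* Below N the truncation of the harvest at N does not alter the event. *)
move=> mb; have mN : (m < N)%N by lia.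
rewrite -(law_harvest hX t); congr (P _); apply/seteqP; split => w /=.
  by move=> /eqP; rewrite outcome_harvest// => /eqP.
by move=> h; apply/eqP; rewrite outcome_harvest//; apply/eqP.
Qed.

Lemma prob_detR t : P (o (4 * t + 3) @^-1` [set 1%N]) = pR%:E.
Proof.
rewrite -(law_detR hX t); congr (P _); apply/seteqP; split => w /=.
  by move=> /eqP; rewrite outcome_detR.
by move=> h; apply/eqP; rewrite outcome_detR.
Qed.

Lemma determined_decodes t k : (0 < k)%N ->
  determined X alpha N (4 * t + k) (fun w => c w t).
Proof. by move=> k0 w w' h; rewrite -!outcome_decodes /o h//; lia. Qed.

Lemma first_subslotE w t s : first_subslot N (static_policy alpha) (x w t) s =
  if c w t then ((s.1 + ~~ detS (x w t))%N, s.2)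
  else (s.1, minn N (s.2 + harvest (x w t))).
Proof. by []. Qed.

Lemma determined_first_subslot t k (s : T -> state) : (2 < k)%N ->
  determined X alpha N (4 * t + k) s ->
  determined X alpha N (4 * t + k)
    (fun w => first_subslot N (static_policy alpha) (x w t) (s w)).
Proof.
move=> k2 ds w w' h; rewrite !first_subslotE (ds w w' h).
rewrite (determined_decodes (ltn_trans _ k2) h)//.
have := h (4 * t + 1)%N; have := h (4 * t + 2)%N; rewrite -/o !outcomeE//=.
move=> h2 h1; case: ifP => _; congr pair.
  by have := h1 ltac:(lia); case: (rv_detS X t w); case: (rv_detS X t w').
(* Truncating the harvest at N does not change the level min(N, q + h). *)
by have := h2 ltac:(lia); lia.
Qed.

Lemma determined_state t : determined X alpha N (4 * t) (fun w => q w t).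
Proof.
elim: t => [//|t ih] w w' h; rewrite /q /= /slot.
have -> : first_subslot N (static_policy alpha) (x w t)
    (state_at K N (static_policy alpha) (x w) s0 t) =
  first_subslot N (static_policy alpha) (x w' t)
    (state_at K N (static_policy alpha) (x w') s0 t).
  apply: (@determined_first_subslot t 3 (q^~ t)) => //.
    by move=> u u' hu; apply: ih => i it; apply: hu; lia.
  by move=> i it; apply: h; lia.
rewrite /second_subslot; case: ifP => // _.
have := h (4 * t + 3)%N; rewrite -/o !outcomeE//= => h3.
by have := h3 ltac:(lia); case: (rv_detR X t w); case: (rv_detR X t w').
Qed.

(** Activity is settled by the first subslot, before the draw [detR] at offset 3; it can therefore
    serve as the weight of that draw. *)
Lemma determined_active t : determined X alpha N (4 * t + 3) (fun w => A w t).
Proof.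
move=> w w' h; rewrite /A /active_at; congr active.
apply: (@determined_first_subslot t 3 (q^~ t)) => //.
by move=> u u' hu; apply: determined_state => i it; apply: hu; lia.
Qed.

Lemma ae_harvest_le : {ae P, forall w t, (harvest (x w t) <= bmax)%N}.
Proof.
apply/ae_foralln => t.
suff : {ae P, forall w m, (bmax < m)%N -> harvest (x w t) <> m}.
  by apply: filterS => w h; rewrite leqNgt; apply/negP => /h.
apply/ae_foralln => m; have [mb|bm] := leqP m bmax; first exact: aeW.
exists (rv_harvest X t @^-1` [set m]); split.
- exact: measurable_funPTI.
- by apply: etrans (law_harvest hX t m) _; rewrite hgamma_supp.
- by move=> w /= h; apply: contrapT => h'; apply: h.
Qed.

(** Each of the four kinds of draw yields an almost sure law of large numbers; on their common event
    [activity_rate] applies path by path. *)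
Lemma active_fraction_cvg :
  {ae P, forall w, (\sum_(0 <= t < n) (A w t)%:R) / n%:R
    @[n --> \oo] --> Num.min (alpha * (1 - pS) / pR)
        ((1 - alpha) * mean_harvest bmax gamma / K%:R)}.
Proof.
have b01 (b : bool) : `|b%:R : R| <= 1 by case: b; rewrite ?normr0 ?normr1.
have mart k := @sublinear_martingale _ _ _ _ X alpha N (law_indep hX) k.
have s_mode := mart 0%N (fun _ _ => 1) 1%N alpha (fun _ _ _ _ => erefl)
  (fun _ _ => b01 true) prob_decodes.
have s_detS := mart 1%N (fun t w => (c w t)%:R) 0%N (1 - pS)
  (fun t w w' h => congr1 (fun b : bool => b%:R)
    (determined_decodes (isT : 0 < 1)%N h))
  (fun _ _ => b01 _) prob_not_detS.
have s_harvest : {ae P, forall w m, (m <= bmax)%N -> sublinear (fun n =>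
    \sum_(0 <= t < n) (~~ c w t)%:R * ((o (4 * t + 2) w == m)%:R - gamma m))}.
  apply/ae_foralln => m; have [mb|bm] := leqP m bmax; last exact: aeW.
  have := mart 2%N (fun t w => (~~ c w t)%:R) m (gamma m)
    (fun t w w' h => congr1 (fun b : bool => (~~ b)%:R)
      (determined_decodes (isT : 0 < 2)%N h))
    (fun _ _ => b01 _) (fun t => prob_harvest t mb).
  by apply: filterS.
have s_detR := mart 3%N (fun t w => (A w t)%:R) 1%N pR
  (fun t w w' h => congr1 (fun b : bool => b%:R) (determined_active h))
  (fun _ _ => b01 _) prob_detR.
have aeI (Q1 Q2 : T -> Prop) : {ae P, forall w, Q1 w} ->
    {ae P, forall w, Q2 w} -> {ae P, forall w, Q1 w /\ Q2 w}.
  by apply: filterS2.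
have := aeI _ _ (aeI _ _ s_mode s_detS)
  (aeI _ _ (aeI _ _ s_harvest s_detR) ae_harvest_le).
apply: filterS => w [[{}s_mode {}s_detS] [[{}s_harvest {}s_detR] hle]].
rewrite -/o in s_mode s_detS s_detR.
have cst n (e : R) : e * n%:R = \sum_(0 <= t < n) e.
  by rewrite sumr_const_nat subn0 mulr_natr.
have -> : (fun n => (\sum_(0 <= t < n) (A w t)%:R) / n%:R) =
    (fun n => (activity K N alpha (x w) s0 n)%:R / n%:R) :> (nat -> R).
  by apply/funext => n; rewrite /activity natr_sum.
apply: (@cvg_sublinear _ (fun n => (activity K N alpha (x w) s0 n)%:R)).
apply: (@activity_rate _ K N bmax) => //; first lia.
(* With c the decoding indicator and u that of a missed detection: c u - alpha (1 - pS) = c (u - (1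
   - pS)) + (1 - pS) (c - alpha). *)
- have := sublinearD s_detS (sublinearZ (1 - pS) s_mode); congr sublinear.
  apply/funext => n; rewrite cst /arrivals natr_sum -sumrB mulr_sumr -big_split.
  apply: eq_bigr => t _ /=; rewrite outcome_detS outcome_decodes -/(c w t).
  by case: (c w t) => /=; case: (rv_detS X t w) => /=; ring.
(* The same splitting is made for each harvest value m, weighted by m; since harvesting is the
   complement of decoding, the mode deviation enters with a minus sign. The guard supplies a
   statement for all m, as [sublinear_sum] requires. *)
- have {}s_harvest m : sublinear (fun n => if (m <= bmax)%N then m%:R *
      (\sum_(0 <= t < n) (~~ c w t)%:R * ((o (4 * t + 2) w == m)%:R - gamma m) +
       gamma m *
         (- \sum_(0 <= t < n) 1 * ((o (4 * t + 0) w == 1%N)%:R - alpha)))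
      else 0).
    case: (leqP m bmax) => mb; last exact: sublinear_cst.
    apply: sublinearZ; apply: sublinearD; first exact: s_harvest.
    by apply: sublinearZ; exact: sublinearN.
  have := sublinear_sum bmax.+1 s_harvest.
  congr sublinear; apply/funext => n.
  rewrite cst /harvested natr_sum -sumrB.
  under eq_bigr => m _ do
    rewrite -ltnS ltn_ord -sumrN mulr_sumr -big_split mulr_sumr.
  rewrite exchange_big; apply: eq_bigr => t _ /=.
  have hN' : (bmax < N)%N by lia.
  have -> : (if decodes alpha (x w) t then 0%N else harvest (x w t))%:R =
     \sum_(m < bmax.+1) m%:R * (~~ c w t)%:R * (harvest (x w t) == m)%:R :> R.
    rewrite (bigD1 (Ordinal (hle t : (_ < bmax.+1)%N)))//=.
    rewrite eqxx mulr1 big1 ?addr0.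
      by rewrite -/(c w t); case: (c w t); rewrite ?mulr1 ?mulr0.
    move=> i; rewrite -val_eqE /= eq_sym => /negbTE ->; rewrite mulr0//.
  rewrite /mean_harvest mulr_sumr -sumrB; apply: eq_bigr => m _.
  rewrite outcome_harvest; last by apply: leq_ltn_trans hN'; rewrite -ltnS.
  rewrite outcome_decodes.
  by case: (c w t) => /=; ring.
- move: s_detR; congr sublinear; apply/funext => n.
  rewrite /departures /activity !natr_sum mulr_sumr -sumrB.
  apply: eq_bigr => t _; rewrite outcome_detR -/(A w t).
  by case: (A w t) => /=; case: (rv_detR X t w) => /=; ring.
Qed.

End Relay.

(** * Crossing of the two rates, optimality and stability *)

Theorem proposition1 (R : realType) (pS pR : R) (bmax K N : nat)
    (gamma : nat -> R)
    (hpS : 0 < pS < 1) (hpR : 0 < pR < 1)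
    (hbmax : (1 <= bmax)%N) (hK : (bmax <= K)%N) (hN : (2 * K <= N)%N)
    (hgamma_ge0 : forall m, 0 <= gamma m)
    (hgamma_supp : forall m, (bmax < m)%N -> gamma m = 0)
    (hgamma_sum : \sum_(m < bmax.+1) gamma m = 1)
    (hgamma_bmax : 0 < gamma bmax)
    (hmean : 0 < mean_harvest bmax gamma)
    (d : measure_display) (T : measurableType d) (P : probability T R)
    (X : random_choices P) (hX : relay_law pS pR gamma X) :
  exists pa : R -> R,
    (forall alpha, 0 <= alpha <= 1 ->
       long_run_active_fraction K N X (static_policy alpha) (pa alpha)) /\
    exists alphaT : R,
      [/\ forall alpha, throughput_optimal pS pR pa alpha <-> alpha = alphaT,
          boundary_of_stability pS pR pa alphaT
        & alphaT = mean_harvest bmax gamma * pR /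
                   (mean_harvest bmax gamma * pR + K%:R * (1 - pS))].
Proof.
have [/andP[_ pS1] /andP[pR0 _]] := (hpS, hpR).
have K0 : 0 < K%:R :> R by rewrite ltr0n; lia.
set mu := mean_harvest bmax gamma in hmean *.
have q0 : 0 < 1 - pS by rewrite subr_gt0.
pose pa a := Num.min (a * (1 - pS) / pR) ((1 - a) * mu / K%:R).
exists pa; split.
  move=> a ha s0 hs0.
  exact: (active_fraction_cvg hbmax hK hN hgamma_supp pR0 hX ha hs0).
pose D := mu * pR + K%:R * (1 - pS).
have D0 : 0 < D by rewrite addr_gt0// mulr_gt0.
pose aT := mu * pR / D; exists aT.
have aT01 : 0 <= aT <= 1.
  apply/andP; split; first by rewrite divr_ge0// ?mulr_ge0// ltW.
  by rewrite ler_pdivrMr// mul1r lerDl mulr_ge0// ltW.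
(* The common value at [aT] of the data-limited and energy-limited rates, hence the maximum of
   [pa]. *)
pose v := mu * (1 - pS) / D.
have vD : aT * (1 - pS) / pR = v by rewrite /aT /v; field; rewrite !gt_eqF.
have vE : (1 - aT) * mu / K%:R = v.
  by rewrite /aT /v /D; field; rewrite -/D !gt_eqF.
have paT : pa aT = v by rewrite /pa vD vE minxx.
(* Below [aT] the increasing data rate is under v, above it the decreasing energy rate is;
   strictness gives uniqueness of the maximizer. *)
have lt_pa b : b < aT -> pa b < v.
  move=> b_lt; rewrite /pa gt_min; apply/orP; left.
  by rewrite -vD ltr_pM2r ?invr_gt0// ltr_pM2r.
have gt_pa b : aT < b -> pa b < v.
  move=> b_gt; rewrite /pa gt_min; apply/orP; right.
  by rewrite -vE ltr_pM2r ?invr_gt0// ltr_pM2r// ltrD2l ltrN2.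
have pa_lt b : b != aT -> pa b < v.
  by rewrite neq_lt => /orP[/lt_pa|/gt_pa].
split => //.
- move=> a; split.
    move=> [_ /(_ _ aT01)]; rewrite /source_throughput lerD2l ler_pM2r// paT.
    by move=> h; apply/eqP; apply: contraTT h => /pa_lt; rewrite -ltNge.
  move=> ->; split => // b _; rewrite /source_throughput lerD2l ler_pM2r// paT.
  by have [->|/pa_lt/ltW//] := eqVneq b aT; rewrite paT.
- split.
    by rewrite /stable /arrival_rate /departure_rate paT -vD divfK// gt_eqF.
  (* Beyond [aT] the activity falls below v while the arrival rate divided by pR rises above it. *)
  move=> b b_gt _; rewrite /unstable /departure_rate /arrival_rate.
  rewrite -ltr_pdivlMr//; apply: (lt_trans (gt_pa _ b_gt)).
  by rewrite -vD ltr_pM2r ?invr_gt0// ltr_pM2r.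
Qed.
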